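(* For all real $x\ge0$ and all $\alpha\in[0,1]$ one has $$\exp\left(-\frac{1}{24(x+\alpha)+12}\right)\le\frac{\widehat{\Pi}(x,\alpha)}{S_{1/2}(x+\alpha)}\le\exp\left(\frac{1}{12(x+\alpha)+12-6\exp(\frac1{12})}\right).$$
   Context: $\Pi(x) := \Gamma(x+1)$ for real $x\ge0$, with $\Gamma$ Euler's gamma function. For $x\ge0$ and $\alpha\in[0,1]$, $\widehat{\Pi}(x,\alpha) := \Pi(x)^{1-\alpha}\,\Pi(x+1)^{\alpha}=\Pi(x)(x+1)^\alpha$. For real $x>-\frac12$, $S_{1/2}(x) := \sqrt{2\pi}\,e^{-1/2}\,(x+\frac12)^{x+\frac12}\,e^{-x}$. *)

(* Defs.v *)
From HB Require Import structures.
From mathcomp Require Import all_boot all_order all_algebra.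
From mathcomp Require Import all_classical all_reals all_analysis.

Set Implicit Arguments.
Unset Strict Implicit.
Unset Printing Implicit Defensive.

Import Order.TTheory GRing.Theory Num.Theory.
Import numFieldNormedType.Exports.

Local Open Scope classical_set_scope.
Local Open Scope ring_scope.

(* Euler's integral of the second kind.  It is Euler's gamma function only for
   0 < x; for x <= 0 the integral diverges and this real-valued integral is the
   default value 0. *)
Definition Gamma (R : realType) (x : R) : R :=
  \int[@lebesgue_measure R]_(t in `]0, +oo[) (t `^ (x - 1) * expR (- t)).

Definition Pi_fun (R : realType) (x : R) : R := Gamma (x + 1).

Definition Pi_hat (R : realType) (x alpha : R) : R :=
  Pi_fun x `^ (1 - alpha) * Pi_fun (x + 1) `^ alpha.

(* Meant for - 1/2 < x, where the base of the power is positive. *)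
Definition S_half (R : realType) (x : R) : R :=
  Num.sqrt (2 * pi) * expR (- (1 / 2)) *
  (x + 1 / 2) `^ (x + 1 / 2) * expR (- x).

(* Main.v *)
Require Import Defs.
From mathcomp Require Import all_boot all_order all_algebra.
From mathcomp Require Import all_classical all_reals all_analysis.
From mathcomp Require Import measurable_realfun ring lra.
Import Order.TTheory GRing.Theory Num.Theory.
Import numFieldNormedType.Exports.
Local Open Scope classical_set_scope.
Local Open Scope ring_scope.

Set Implicit Arguments.
Unset Strict Implicit.
Unset Printing Implicit Defensive.

(** Write $E(z) = z \ln z - z + \frac12\ln(2\pi)$.  Then $S_{1/2}(y)$ is the
    exponential of $E(y+\frac12)$, and the functional equation turns
    $\widehat\Pi(x,\alpha)$ into $\Gamma(x+1)(x+1)^\alpha$, so both bounds concern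
    the real number
    $$L(x,\alpha) = \ln\Gamma(x+1) + \alpha\ln(x+1) - E(x+\alpha+\tfrac12)$$
    ([log_ratio]), which is concave in $\alpha$ with its maximum at
    $\alpha = \frac12$.

    Lower bound.  At $\alpha = 0$ it says that the error
    $\mu(x) = \ln\Gamma(x+1) - E(x+\frac12)$ is at least $-1/(24x+12)$
    ([stirling_error_ge]).  The increments $\mu(x+1)-\mu(x)$ are elementary; they
    lie between 0 and the decrement of $1/(24x+12)$
    ([stirling_error_step]), so that it is enough to know that $\mu(x+n)$ tends
    to 0.  The case $\alpha\ge\frac12$ follows by comparison with $\alpha=1$, where
    $L(x,1) = \mu(x+1)$; the case $\alpha\le\frac12$ by comparison with
    $\alpha = 0$.

    Upper bound.  At $\alpha = \frac12$ the number $L$ is Binet's function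
    $J(m) = \ln\Gamma(m) + \frac12\ln m - E(m)$ at $m = x+1$, and telescoping
    gives $J(m)\le 1/(12m)$ ([binet_le]).  For $\alpha = \frac12 + s$ one has
    $L = J(m) - m\,\varphi(s/m)$ with $\varphi(u) = (1+u)\ln(1+u) - u$, and
    Bennett's lower bound for $\varphi$ ([bennett_ge]) leads to
    $L \le 1/(12(m+s-c))$ with $c = \frac1{24}$.  This is the least $c$ which
    keeps $6s^2 - s + c\ge 0$ for all $s$.  The bound of the theorem has
    $c = (e^{1/12}-1)/2$, which is larger because $e^{1/12} > 1 + \frac1{12}$.

    The limit of $\mu$ is Stirling's formula with its constant.
    Log-convexity of $\Gamma$, in the form
    $\Gamma(s+x)\le s^x\,\Gamma(s)$ ([Gamma_shift_le]), makes $\mu(s+x)-\mu(s)$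
    small for $0\le x\le1$ and $s$ large, so that one limit $\ell$, along the
    integers, serves all $x$.  Legendre's duplication formula at half-integers,
    whose constant comes from $\Gamma(\frac32) = \sqrt\pi/2$
    ([Gamma_three_half]), says that $\mu(n-\frac12)+\mu(n)-\mu(2n)\to0$;
    hence $2\ell - \ell = 0$. *)

(** * Elementary inequalities for the logarithm *)

Section derivative_rules.
Context {R : realType}.
Implicit Types (f g : R -> R) (x a b c : R).

Lemma is_derive_fun_cst c x : is_derive x 1 (fun=> c) 0.
Proof. exact: is_derive_cst. Qed.

Lemma is_derive_fun_id x : is_derive x 1 (fun y : R => y) 1.
Proof. exact: is_derive_id. Qed.

Lemma is_derive_funD f g x a b : is_derive x 1 f a -> is_derive x 1 g b ->
  is_derive x 1 (fun y => f y + g y) (a + b).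
Proof. by move=> ? ?; exact: is_deriveD. Qed.

Lemma is_derive_funN f x a : is_derive x 1 f a -> is_derive x 1 (fun y => - f y) (- a).
Proof. by move=> ?; exact: is_deriveN. Qed.

Lemma is_derive_funM f g x a b : is_derive x 1 f a -> is_derive x 1 g b ->
  is_derive x 1 (fun y => f y * g y) (f x * b + g x * a).
Proof. by move=> ? ?; exact: is_deriveM. Qed.

Lemma is_derive_fun_expR f x a : is_derive x 1 f a ->
  is_derive x 1 (fun y => expR (f y)) (expR (f x) * a).
Proof. by move=> ?; exact: (@is_derive1_comp R expR). Qed.

Lemma is_derive_fun_ln f x a : 0 < f x -> is_derive x 1 f a ->
  is_derive x 1 (fun y => ln (f y)) ((f x)^-1 * a).
Proof. by move=> /is_derive1_ln ? ?; exact: (@is_derive1_comp R (@ln R)). Qed.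

Lemma is_derive_funV f x a : f x != 0 -> is_derive x 1 f a ->
  is_derive x 1 (fun y => (f y)^-1) (- (f x) ^- 2 * a).
Proof. by move=> ? ?; exact: is_deriveV. Qed.

End derivative_rules.

(** Differentiation by recursion on the expression, with the nonvanishing or the
    positivity of the arguments of inverses and logarithms as side goals.  Type
    class resolution is kept out: it would return the derivative in terms of the
    scaling of a normed module, which [field] does not read. *)
Ltac differentiate :=
  simple notypeclasses refine (is_derive_eq _ _);
  [ | repeat first [ notypeclasses refine (is_derive_fun_cst _ _)
                   | notypeclasses refine (is_derive_fun_id _)
                   | simple notypeclasses refine (is_derive_funD _ _)
                   | simple notypeclasses refine (is_derive_funN _)
                   | simple notypeclasses refine (is_derive_funM _ _)
                   | simple notypeclasses refine (is_derive_fun_expR _)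
                   | simple notypeclasses refine (is_derive_fun_ln _ _)
                   | simple notypeclasses refine (is_derive_funV _ _) ]
    | ]; rewrite /=.

Lemma ge0_of_derive_ge0 (R : realType) (f df : R -> R) (b : R) :
  0 <= b -> f 0 = 0 ->
  (forall x, 0 <= x <= b -> is_derive x 1 f (df x)) ->
  (forall x, 0 <= x <= b -> 0 <= df x) ->
  0 <= f b.
Proof.
move=> b0 f0 fD df0; rewrite -f0.
have mem x : x \in `]0, b[ -> 0 <= x <= b.
  by rewrite in_itv/= => /andP[/ltW -> /ltW ->].
apply: (@ger0_derive1_ndecr _ f 0 b) => //.
- by move=> x /mem/fD[].
- by move=> x /mem xb; rewrite derive1E; have [_ ->] := fD _ xb; apply: df0.
- apply: derivable_within_continuous => x; rewrite in_itv/= => /fD[].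
  by [].
Qed.

Lemma ln_ge_1BV (R : realType) (x : R) : 0 < x -> 1 - x^-1 <= ln x.
Proof.
move=> x0; have := @le_ln1Dx R (x^-1 - 1).
have -> : 1 + (x^-1 - 1) = x^-1 by lra.
rewrite lnV ?posrE// => h.
have : 0 < x^-1 by rewrite invr_gt0.
move=> xV; have := h ltac:(lra); lra.
Qed.

Lemma ln_le_B1 (R : realType) (x : R) : 0 < x -> ln x <= x - 1.
Proof. by move=> x0; have := @le_ln1Dx R (x - 1) ltac:(lra); rewrite addrC subrK. Qed.

(** The derivative of the difference is $u^2/((1+u)(2+u)^2)$. *)
Lemma ln1D_ge_pade (R : realType) (u : R) : 0 <= u -> 2 * u / (2 + u) <= ln (1 + u).
Proof.
move=> u0; rewrite -subr_ge0.
pose f (x : R) := ln (1 + x) - 2 * x * (2 + x)^-1.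
pose df (x : R) := (1 + x)^-1 - 4 / (2 + x) ^+ 2.
rewrite -/(f u); apply: (@ge0_of_derive_ge0 _ f df) => //.
- by rewrite /f; rewrite addr0 ln1 mulr0 mul0r subr0.
- move=> x /andP[x0 _].
  have h1 : 0 < 1 + x by lra.
  have h2 : 2 + x != 0 by lra.
  rewrite /f/df; differentiate => //.
  by field; apply/andP; split; lra.
- move=> x /andP[x0 _]; rewrite /df.
  rewrite subr_ge0 ler_pdivrMr; last by rewrite exprn_gt0//; lra.
  by rewrite ler_pdivlMl; [nra|lra].
Qed.

Lemma ln_le_half_sub_inv (R : realType) (u : R) : 0 <= u -> ln (1 + u) <= u - u ^+ 2 / (2 * (1 + u)).
Proof.
move=> u0; rewrite -subr_ge0.
pose f (x : R) := x - x * x * (2 * (1 + x))^-1 - ln (1 + x).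
pose df (x : R) := x ^+ 2 / (2 * (1 + x) ^+ 2).
have -> : u - u ^+ 2 / (2 * (1 + u)) - ln (1 + u) = f u by rewrite /f expr2.
apply: (@ge0_of_derive_ge0 _ f df) => //.
- by rewrite /f addr0 ln1; ring.
- move=> x /andP[x0 _].
  by rewrite /f/df; differentiate; [lra|lra|field; lra].
- move=> x /andP[x0 _]; apply: divr_ge0; first exact: sqr_ge0.
  by apply: mulr_ge0 => //; exact: sqr_ge0.
Qed.

(** Bennett's inequality, in the form $\varphi(u)\ge u^2/(2(1+u/3))$.  After one
    differentiation it is weaker than [ln1D_ge_pade]. *)
Lemma bennett_ge (R : realType) (u : R) : 0 <= u ->
  3 * u ^+ 2 / (2 * (3 + u)) <= (1 + u) * ln (1 + u) - u.
Proof.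
move=> u0; rewrite -subr_ge0.
pose f (x : R) := (1 + x) * ln (1 + x) - x - 3 * (x * x) * (2 * (3 + x))^-1.
pose df (x : R) := ln (1 + x) - 3 * (x * (x + 6)) / (2 * (3 + x) ^+ 2).
have -> : (1 + u) * ln (1 + u) - u - 3 * u ^+ 2 / (2 * (3 + u)) = f u.
  by rewrite /f expr2.
apply: (@ge0_of_derive_ge0 _ f df) => //.
- by rewrite /f; rewrite addr0 ln1; ring.
- move=> x /andP[x0 _].
  rewrite /f/df; differentiate; [lra|lra|].
  by field; apply/andP; split; lra.
- move=> x /andP[x0 _]; rewrite /df subr_ge0.
  apply: (le_trans _ (ln1D_ge_pade x0)).
  rewrite ler_pdivrMr; [|nra].
  rewrite mulrAC ler_pdivlMr; [|lra].
  rewrite -subr_ge0.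
  have -> : 2 * x * (2 * (3 + x) ^+ 2) - 3 * (x * (x + 6)) * (2 + x) = x ^+ 3 by ring.
  exact: exprn_ge0.
Qed.

(** With $t = 1/(2m)$, the function
    $q(t) = (1+t)\ln(1+t)-(1-t)\ln(1-t) = 2t - \sum_{k\ge1} t^{2k+1}/(k(2k+1))$
    gives the increment $E(m+\frac12)-E(m-\frac12) = \ln m - 1 + m\,q(t)$ of the
    Stirling exponent $E(z) = z\ln z - z + \frac12\ln(2\pi)$. *)
Lemma entropy_le (R : realType) (t : R) : 0 <= t < 1 ->
  (1 + t) * ln (1 + t) - (1 - t) * ln (1 - t) <= 2 * t.
Proof.
move=> /andP[t0 t1]; rewrite -subr_ge0.
pose f (x : R) := 2 * x - ((1 + x) * ln (1 + x) - (1 - x) * ln (1 - x)).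
pose df (x : R) := - ln (1 + x) - ln (1 - x).
rewrite -/(f t); apply: (@ge0_of_derive_ge0 _ f df) => //.
- by rewrite /f addr0 subr0 ln1; ring.
- move=> x /andP[x0 xt]; rewrite /f/df; differentiate; [lra|lra|].
  by field; apply/andP; split; lra.
- move=> x /andP[x0 xt]; rewrite /df.
  have := @ln_le_B1 R (1 + x) ltac:(lra).
  have := @ln_le_B1 R (1 - x) ltac:(lra).
  lra.
Qed.

(** The derivative of the cubic correction $t^3/(3(1-t^2))$ dominates
    $-\ln(1-t^2)$, up to a constant the derivative of $q$. *)
Lemma Nln1BX2_le (R : realType) (x : R) : 0 <= x < 1 ->
  - ln (1 - x ^+ 2) <= (3 * x ^+ 2 - x ^+ 4) / (3 * (1 - x ^+ 2) ^+ 2).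
Proof.
move=> /andP[x0 x1].
have v1 : 0 < 1 - x ^+ 2 by nra.
have := ln_ge_1BV v1.
suff : (1 - x ^+ 2)^-1 - 1 <= (3 * x ^+ 2 - x ^+ 4) / (3 * (1 - x ^+ 2) ^+ 2) by lra.
rewrite ler_pdivlMr; last by rewrite mulr_gt0 ?exprn_gt0.
rewrite -subr_ge0.
have -> : 3 * x ^+ 2 - x ^+ 4 - ((1 - x ^+ 2)^-1 - 1) * (3 * (1 - x ^+ 2) ^+ 2)
  = 2 * x ^+ 4 by field; lra.
by rewrite mulr_ge0 ?exprn_ge0.
Qed.

(** The correction is a geometric majorant of the tail $\sum t^{2k+1}/(k(2k+1))$,
    chosen because $m\,t^3/(3(1-t^2))$ with $t = 1/(2m)$ telescopes. *)
Lemma entropy_ge (R : realType) (t : R) : 0 <= t < 1 ->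
  2 * t - t ^+ 3 / (3 * (1 - t ^+ 2)) <=
  (1 + t) * ln (1 + t) - (1 - t) * ln (1 - t).
Proof.
move=> /andP[t0 t1]; rewrite -subr_ge0.
pose f (x : R) := (1 + x) * ln (1 + x) - (1 - x) * ln (1 - x) -
  (2 * x - x * (x * x) * (3 * (1 - x * x))^-1).
pose df (x : R) := ln (1 + x) + ln (1 - x)
  + (3 * x ^+ 2 - x ^+ 4) / (3 * (1 - x ^+ 2) ^+ 2).
have -> : (1 + t) * ln (1 + t) - (1 - t) * ln (1 - t) -
  (2 * t - t ^+ 3 / (3 * (1 - t ^+ 2))) = f t by rewrite /f !exprS !expr0 !mulr1.
apply: (@ge0_of_derive_ge0 _ f df) => //.
- by rewrite /f addr0 subr0 ln1; ring.
- move=> x /andP[x0 xt]; rewrite /f/df; differentiate; [lra|lra|nra|].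
  by field; apply/and3P; split; nra.
- move=> x /andP[x0 xt]; rewrite /df.
  have x1 : 0 <= x < 1 by rewrite x0 (le_lt_trans xt).
  have := Nln1BX2_le x1.
  have -> : 1 - x ^+ 2 = (1 + x) * (1 - x) by ring.
  rewrite lnM ?posrE; [lra|lra|lra].
Qed.

(** Same choice of a telescoping correction, now for
    $\ln\frac{1+t}{1-t}$ with $t = 1/(2m+1)$, that is for $\ln(1+1/m)$. *)
Lemma artanh_le (R : realType) (t : R) : 0 <= t < 1 ->
  ln (1 + t) - ln (1 - t) <= 2 * t + 2 * t ^+ 3 / (3 * (1 - t ^+ 2)).
Proof.
move=> /andP[t0 t1]; rewrite -subr_ge0.
pose f (x : R) := 2 * x + 2 * (x * (x * x)) * (3 * (1 - x * x))^-1 -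
  (ln (1 + x) - ln (1 - x)).
pose df (x : R) := 4 * x ^+ 4 / (3 * (1 - x ^+ 2) ^+ 2).
have -> : 2 * t + 2 * t ^+ 3 / (3 * (1 - t ^+ 2)) - (ln (1 + t) - ln (1 - t))
  = f t by rewrite /f !exprS !expr0 !mulr1.
apply: (@ge0_of_derive_ge0 _ f df) => //.
- by rewrite /f addr0 subr0 ln1; ring.
- move=> x /andP[x0 xt]; rewrite /f/df; differentiate; [nra|lra|lra|].
  field; by apply/and3P; split; nra.
- move=> x /andP[x0 xt]; rewrite /df.
  by rewrite divr_ge0 ?mulr_ge0 ?exprn_ge0//; nra.
Qed.

(** * Integrals of exponentially dominated functions *)

(** Half of the exponential is spent on the power, the other half is kept for
    integrability. *)
Lemma powR_le_expR_half (R : realType) (a : R) : 0 <= a ->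
  exists C : R, forall t, 0 <= t -> t `^ a <= C * expR (t / 2).
Proof.
move=> a0; have [n an] : exists n : nat, a <= n.+1%:R.
  by exists (Num.bound a); rewrite (le_trans (ltW (archi_boundP a0)))// ler_nat.
pose K : R := 2 ^+ n.+1 * n.+1`!%:R.
have K0 : 0 < K by rewrite mulr_gt0// ?exprn_gt0// ltr0n fact_gt0.
exists (1 + K) => t t0.
have ht : 0 <= t / 2 by rewrite divr_ge0.
have e1 : 1 <= expR (t / 2) by have := expR_ge1Dx (t / 2); lra.
have tn : t ^+ n.+1 <= K * expR (t / 2).
  have Kt : t ^+ n.+1 = K * ((t / 2) ^+ n.+1 / n.+1`!%:R).
    rewrite exprMn exprVn /K; field.
    by rewrite expf_neq0// pnatr_eq0 -lt0n fact_gt0.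
  by rewrite Kt ler_pM2l//; have := expR_ge1Dxn n ht; lra.
have : t `^ a <= 1 + t ^+ n.+1.
  have tn0 : 0 <= t ^+ n.+1 by rewrite exprn_ge0.
  have [t1|t1] := leP t 1.
    suff : t `^ a <= 1 by lra.
    by rewrite (le_trans (ge0_ler_powR a0 _ _ t1)) ?nnegrE ?powR1.
  rewrite (@le_trans _ _ (t `^ n.+1%:R))// ?ler_powR// ?(ltW t1)//.
  by rewrite powR_mulrn//; lra.
nra.
Qed.

Section dominated_FTC.
Context {R : realType}.
Notation mu := (@lebesgue_measure R).

Let h (t : R) := expR (- (t / 2)).

Let dh (t : R) : is_derive t 1 (fun t => - 2 * h t) (h t).
Proof. by rewrite /h; differentiate; field. Qed.

Let ch : continuous h.
Proof.
move=> t; apply: differentiable_continuous; apply/derivable1_diffP.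
by have [] : is_derive t 1 h (- 2^-1 * h t) by rewrite /h; differentiate; field.
Qed.

Lemma cvg_expR_half : h t @[t --> +oo] --> (0 : R).
Proof.
apply: (cvg_comp (fun t : R => t / 2) (fun t => expR (- t))); last exact: cvgr_expR.
by apply: gt0_cvgMly; [|exact: cvg_id].
Qed.

Lemma integrable_expR_half : mu.-integrable `[0, +oo[ (EFin \o h).
Proof.
have mh : measurable_fun [set: R] h by exact: continuous_measurable_fun.
apply/integrableP; split.
  by apply/measurable_EFinP; exact: measurable_funTS.
under eq_integral do rewrite /= ger0_norm ?expR_ge0//.
rewrite (@ge0_continuous_FTC2y _ h (fun t => - 2 * h t) 0 0) ?ltry//.
- by move=> t _; exact: expR_ge0.
- exact: continuous_subspaceT.
- rewrite -[X in _ --> X](mulr0 (- 2)); apply: cvgM; [exact: cvg_cst|exact: cvg_expR_half].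
- by apply: cvg_at_right_filter; apply: cvgM; [exact: cvg_cst|exact: ch].
- by move=> t _; rewrite derive1E; have [_ ->] := dh t.
Qed.

Lemma integrable_exp_dominated (f : R -> R) C :
  {within `[0, +oo[, continuous f} ->
  (forall t, 0 <= t -> `|f t| <= C * h t) ->
  mu.-integrable `[0, +oo[ (EFin \o f).
Proof.
move=> cf fC.
apply: (@le_integrable _ _ _ mu _ _ _ (EFin \o (fun t => C * h t))) => //.
- by apply/measurable_EFinP; exact: subspace_continuous_measurable_fun.
- move=> t /=; rewrite in_itv/= andbT => t0; rewrite lee_fin.
  exact: le_trans (fC _ t0) (ler_norm _).
- have := integrableZl _ C integrable_expR_half; apply => //.
Qed.

(** Newton-Leibniz on a half-line for a function of variable sign: adding the
    multiple [C * h] of an integrable function with known primitive makes it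
    nonnegative, and the added integral is subtracted afterwards. *)
Lemma Rintegral_dominated_FTC2y (f F : R -> R) (C l : R) :
  {within `[0, +oo[, continuous f} ->
  (forall t, 0 <= t -> `|f t| <= C * h t) ->
  (forall t : R, 0 < t -> is_derive t 1 F (f t)) ->
  F t @[t --> 0^'+] --> F 0 ->
  F t @[t --> +oo] --> l ->
  \int[mu]_(t in `[0, +oo[) f t = l - F 0.
Proof.
move=> cf fC dF F0 Fl.
have iF := integrable_exp_dominated cf fC.
have ch' : {within `[0, +oo[, continuous h} by exact: continuous_subspaceT.
pose H t := - 2 * h t.
have hl : H t @[t --> +oo] --> 0.
  by rewrite -[X in _ --> X](mulr0 (- 2)); apply: cvgM; [exact: cvg_cst|exact: cvg_expR_half].
have H0 : H t @[t --> 0^'+] --> H 0.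
  by apply: cvg_at_right_filter; apply: cvgM; [exact: cvg_cst|exact: ch].
have intH : \int[mu]_(t in `[0, +oo[) (C * h t) = 0 - C * H 0.
  rewrite RintegralZl//; last exact: integrable_expR_half.
  rewrite (@Rintegral_ge0_continuous_FTC2y _ h H 0 0) ?sub0r ?mulrN//.
  - by move=> t _; exact: expR_ge0.
  - by move=> t _; rewrite derive1E; have [_ ->] := dh t.
have iCh : mu.-integrable `[0, +oo[ (EFin \o (fun t => C * h t)).
  by have := integrableZl _ C integrable_expR_half; apply.
have : \int[mu]_(t in `[0, +oo[) (f t + C * h t) = l + C * 0 - (F 0 + C * H 0).
  have dG (t : R) : 0 < t -> is_derive t 1 (fun t => F t + C * H t) (f t + C * h t).
    move=> t0; have := is_derive_funD (dF _ t0) (is_derive_funM (is_derive_fun_cst C t) (dh t)).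
    by rewrite mulr0 addr0.
  apply: (@Rintegral_ge0_continuous_FTC2y _ _ (fun t => F t + C * H t)).
  - by move=> t /fC; rewrite ler_norml; lra.
  - move=> t; apply: cvgD; first exact: cf.
    by apply: cvgM; [exact: cvg_cst|exact: ch'].
  - by apply: cvgD => //; apply: cvgM => //; exact: cvg_cst.
  - by move=> t t0; have [] := dG _ t0.
  - by apply: cvgD => //; apply: cvgM => //; exact: cvg_cst.
  - by move=> t; rewrite in_itv/= andbT => t0; rewrite derive1E; have [_ ->] := dG _ t0.
by rewrite RintegralD// intH; lra.
Qed.
End dominated_FTC.

(** * Euler's gamma function on $[1,+\infty)$ *)

Section Gamma_theory.
Context {R : realType}.
Notation mu := (@lebesgue_measure R).
Implicit Types s t x : R.

Let g s t : R := t `^ (s - 1) * expR (- t).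

Lemma is_derive_fun_powR (a t : R) : 0 < t ->
  is_derive t 1 (fun t : R => t `^ a) (a * t `^ (a - 1)).
Proof. by move=> t0; exact: is_derive1_powR. Qed.

Let dg s t : 0 < t ->
  is_derive t 1 (g s) (t `^ (s - 1) * - expR (- t) + expR (- t) * ((s - 1) * t `^ (s - 2))).
Proof.
move=> t0; rewrite /g.
have d1 := is_derive_fun_powR (s - 1) t0.
have d2 := is_derive_fun_expR (is_derive_funN (is_derive_fun_id t)).
have := is_derive_funM d1 d2.
by rewrite mulrN1 (_ : s - 1 - 1 = s - 2)//; ring.
Qed.

(** The exponent 0 is included, with value $0^0 = 1$: the integrand of $\Gamma(1)$
    is continuous at 0. *)
Lemma cvg_at_right_powR (a : R) : 0 <= a -> t `^ a @[t --> 0^'+] --> 0 `^ a.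
Proof.
rewrite le_eqVlt => /predU1P[<-|a0]; last by rewrite powR0 ?gt_eqF//; exact: powR_cvg0.
under eq_fun do rewrite powRr0.
by rewrite powRr0; exact: cvg_cst.
Qed.

Let g0 s : 1 <= s -> g s t @[t --> 0^'+] --> g s 0.
Proof.
move=> s1; apply: cvgM; first by apply: cvg_at_right_powR; lra.
apply: cvg_at_right_filter; apply: continuous_comp; first exact: opp_continuous.
exact: continuous_expR.
Qed.

Let cg s : 1 <= s -> {within `[0, +oo[, continuous (g s)}.
Proof.
move=> s1; apply: derivable_oy_Rcontinuous_within_itvcy; split; last exact: g0.
by move=> t; rewrite in_itv/= andbT => /(dg s)[].
Qed.

Let g_bound s : 1 <= s -> exists C : R, forall t, 0 <= t -> `|g s t| <= C * expR (- (t / 2)).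
Proof.
move=> s1; have [C CP] := @powR_le_expR_half R (s - 1) ltac:(lra).
exists C => t t0; rewrite /g ger0_norm ?mulr_ge0 ?powR_ge0 ?expR_ge0//.
rewrite (_ : - (t / 2) = t / 2 + - t); last by lra.
by rewrite expRD mulrA ler_wpM2r ?expR_ge0// CP.
Qed.

Let int_g s : 1 <= s -> mu.-integrable `[0, +oo[ (EFin \o g s).
Proof. by move=> s1; have [C] := g_bound s1; exact: integrable_exp_dominated (cg s1). Qed.

Let int_g' s : 1 <= s -> mu.-integrable `]0, +oo[ (EFin \o g s).
Proof.
move=> /int_g; apply: integrableS => //.
by apply: subset_itvr; rewrite bnd_simp.
Qed.

Lemma Gamma_itvcy s : 1 <= s ->
  Gamma s = \int[mu]_(t in `[0, +oo[) (t `^ (s - 1) * expR (- t)).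
Proof. by move=> s1; rewrite -Rintegral_itv_obnd_cbnd//; exact: int_g'. Qed.

Let g_cvgy s : 1 <= s -> g s t @[t --> +oo] --> 0.
Proof.
move=> s1; have [C CP] := g_bound s1.
have Ch : C * expR (- (t / 2)) @[t --> +oo] --> 0.
  by rewrite -[X in _ --> X](mulr0 C); apply: cvgM; [exact: cvg_cst|exact: cvg_expR_half].
have NCh : - (C * expR (- (t / 2))) @[t --> +oo] --> 0.
  by rewrite -[X in _ --> X]oppr0; apply: cvgN.
apply: (squeeze_cvgr _ NCh Ch); near=> t.
rewrite -ler_norml; apply: CP; near: t; exact: nbhs_pinfty_ge.
Unshelve. all: by end_near. Qed.

Lemma Gamma1 : Gamma 1 = 1 :> R.
Proof.
have [C CP] := @g_bound 1 (lexx _).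
rewrite Gamma_itvcy//.
transitivity (0 - - expR (- (0 : R))); last by rewrite oppr0 expR0 opprK add0r.
apply: (@Rintegral_dominated_FTC2y _ (g 1) (fun t => - expR (- t)) C 0) => //.
- exact: cg.
- move=> t t0; rewrite /g subrr powRr0 mul1r.
  by differentiate; ring.
- apply: cvg_at_right_filter; apply: cvgN; apply: continuous_comp; first exact: opp_continuous.
  exact: continuous_expR.
- by rewrite -[X in _ --> X]oppr0; apply: cvgN; exact: cvgr_expR.
Qed.

(** The difference of the two integrands is the derivative of $-t^s e^{-t}$, which
    vanishes at both ends. *)
Lemma GammaS s : 1 <= s -> Gamma (s + 1) = s * Gamma s.
Proof.
move=> s1; have s2 : 1 <= s + 1 by lra.
have [C CP] := g_bound s1; have [D DP] := g_bound s2.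
have isg : mu.-integrable `[0, +oo[ (EFin \o (fun t => s * g s t)).
  by have := integrableZl _ s (int_g s1); apply.
have := @Rintegral_dominated_FTC2y _ (fun t => g (s + 1) t - s * g s t)
  (fun t => - g (s + 1) t) (D + s * C) 0.
rewrite RintegralB//; last exact: int_g.
rewrite RintegralZl//; last exact: int_g.
rewrite -!Gamma_itvcy//.
have gz : g (s + 1) 0 = 0 by rewrite /g powR0 ?mul0r//; apply/eqP; lra.
rewrite gz.
move=> h; apply/eqP; rewrite -subr_eq0; apply/eqP.
transitivity (0 - - (0 : R)); last by rewrite opprK addr0.
apply: h.
- move=> t; apply: cvgB; first exact: cg.
  by apply: cvgM; [exact: cvg_cst|exact: cg].
- move=> t t0; have := CP _ t0; have := DP _ t0; rewrite !ler_norml; nra.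
- move=> t t0; have := is_derive_funN (dg (s + 1) t0) => dG; apply: (is_derive_eq dG).
  rewrite /g (_ : s + 1 - 2 = s - 1); last by ring.
  by rewrite addrK; ring.
- by apply: cvgN; rewrite -[X in _ --> X]gz; exact: g0.
- by rewrite -[X in _ --> X]oppr0; apply: cvgN; exact: g_cvgy.
Qed.

(** Weighted arithmetic-geometric inequality for $u$ and 1: with
    $w = 1 + x(u-1)$, the bound $\ln v\le v-1$ at $v = u/w$ and at $v = 1/w$,
    weighted by $x$ and $1-x$, sums to 0. *)
Lemma powR_le_bernoulli (u x : R) : 0 < u -> 0 <= x <= 1 -> u `^ x <= 1 + x * (u - 1).
Proof.
move=> u0 /andP[x0 x1].
have w0 : 0 < 1 + x * (u - 1) by nra.
rewrite -ler_ln ?posrE ?powR_gt0// ln_powR.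
set w := 1 + _ in w0 *.
have w0' : w != 0 by rewrite gt_eqF.
have uw : 0 < u / w by rewrite divr_gt0.
have wV : 0 < w^-1 by rewrite invr_gt0.
have := ler_wpM2l x0 (ln_le_B1 uw).
have := ler_wpM2l (_ : 0 <= 1 - x) (ln_le_B1 wV).
rewrite subr_ge0 => /(_ x1).
rewrite ln_div ?posrE// lnV ?posrE//.
have : x * (u / w - 1) + (1 - x) * (w^-1 - 1) = 0 by rewrite /w; field.
lra.
Qed.

(** This consequence of log-convexity is proved without Hoelder's inequality:
    Bernoulli's inequality bounds $t^x$ by $s^x(1+x(t/s-1))$ pointwise, and the
    linear term integrates to 0 against $t^{s-1}e^{-t}$ because
    $\Gamma(s+1) = s\,\Gamma(s)$. *)
Lemma Gamma_shift_le s x : 1 <= s -> 0 <= x <= 1 -> Gamma (s + x) <= s `^ x * Gamma s.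
Proof.
move=> s1 /[dup] x01 /andP[x0 x1].
have s0 : 0 < s by lra.
have is1 : mu.-integrable `]0, +oo[ (EFin \o (fun t => (s `^ x * (1 - x)) * g s t)).
  by have := integrableZl _ (s `^ x * (1 - x)) (@int_g' s s1); apply.
have s2 : 1 <= s + 1 by lra.
have is2 : mu.-integrable `]0, +oo[ (EFin \o (fun t => (s `^ x * x / s) * g (s + 1) t)).
  by have := integrableZl _ (s `^ x * x / s) (@int_g' (s + 1) s2); apply.
have -> : s `^ x * Gamma s = \int[mu]_(t in `]0, +oo[)
    ((s `^ x * (1 - x)) * g s t + (s `^ x * x / s) * g (s + 1) t).
  rewrite RintegralD// RintegralZl//; last exact: int_g'.
  rewrite RintegralZl//; last exact: int_g'.
  rewrite -/(Gamma s) -/(Gamma (s + 1)) GammaS//.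
  by field; lra.
apply: le_Rintegral => //.
- by apply: int_g'; lra.
- by have := integrableD _ is1 is2; apply.
move=> t /=; rewrite in_itv/= andbT => t0.
have -> : t `^ (s + x - 1) = t `^ (s - 1) * t `^ x.
  by rewrite -powRD ?(gt_eqF t0) ?implybT//; congr (_ `^ _); ring.
have := @powR_le_bernoulli (t / s) x (divr_gt0 t0 s0) x01.
have -> : g (s + 1) t = t * g s t.
  by rewrite /g mulrA mulr_powRB1 ?addrK ?(ltW t0)//; lra.
have -> : t `^ x = s `^ x * (t / s) `^ x.
  by rewrite -powRM ?divr_ge0 ?ltW// mulrC divfK// gt_eqF.
move=> h; rewrite mulrAC.
have -> : s `^ x * (1 - x) * g s t + s `^ x * x / s * (t * g s t) =
  g s t * (s `^ x * (1 + x * (t / s - 1))) by field; lra.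
rewrite -/(g s t); apply: ler_wpM2l.
  by rewrite mulr_ge0 ?powR_ge0 ?expR_ge0.
by rewrite ler_wpM2l ?powR_ge0.
Qed.

Lemma Gamma_nat_gt0 n : 0 < Gamma (n.+1%:R : R).
Proof.
elim: n => [|n ih]; first by rewrite Gamma1.
rewrite -natr1 GammaS; first by rewrite mulr_gt0.
by rewrite ler1n.
Qed.

(** [Gamma_shift_le] bounds the factorial at the next integer by a multiple of
    $\Gamma(s)$. *)
Lemma Gamma_gt0 s : 1 <= s -> 0 < Gamma s.
Proof.
move=> s1; have s0 : 0 <= s by lra.
pose n := Num.truncn s.
have /andP[ns sn] := truncn_itv s0.
have := @Gamma_shift_le s (n.+1%:R - s) s1.
have -> : s + (n.+1%:R - s) = n.+1%:R by rewrite addrC subrK.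
move=> h; have {}h := lt_le_trans (Gamma_nat_gt0 n) (h _).
rewrite -(pmulr_rgt0 _ (powR_gt0 (n.+1%:R - s) (lt_le_trans ltr01 s1))).
apply: h; rewrite subr_ge0 (ltW sn)/= lerBlDr -natr1 addrC lerD2l.
exact: ns.
Qed.

End Gamma_theory.

(** * The value at 3/2 *)

Section Gamma_three_half.
Context {R : realType}.
Notation mu := (@lebesgue_measure R).

Let k (u : R) : R := 2 * u ^+ 2 * gauss_fun u.

Let gauss_le (u : R) : gauss_fun u <= expR 1 * expR (- u).
Proof. by rewrite /gauss_fun -expRD ler_expR; nra. Qed.

Let powX_gauss_bound (n : nat) :
  exists C : R, forall u : R, 0 <= u -> u ^+ n * gauss_fun u <= C * expR (- (u / 2)).
Proof.
have [C CP] := @powR_le_expR_half R n%:R (ler0n _ n).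
exists (C * expR 1) => u u0.
rewrite (le_trans (ler_wpM2l _ (gauss_le u))) ?exprn_ge0//.
have -> : C * expR 1 * expR (- (u / 2)) = C * expR (u / 2) * (expR 1 * expR (- u)).
  rewrite (_ : - (u / 2) = u / 2 + - u); last by lra.
  by rewrite expRD; ring.
by rewrite ler_wpM2r ?mulr_ge0 ?expR_ge0// -powR_mulrn// CP.
Qed.

Let ck : continuous k.
Proof.
move=> u; apply: cvgM; last exact: continuous_gauss_fun.
by apply: cvgM; [exact: cvg_cst|exact: exprn_continuous].
Qed.

Let k0 (u : R) : 0 <= k u.
Proof. by rewrite /k; apply: mulr_ge0; [apply: mulr_ge0; rewrite ?sqr_ge0|exact: expR_ge0]. Qed.

Let XyE (u : R) : is_derive u 1 (fun u => - (u * gauss_fun u))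
  (2 * u ^+ 2 * gauss_fun u - gauss_fun u).
Proof.
have -> : (fun u : R => - (u * gauss_fun u)) = (fun u => - (u * expR (- (u * u)))).
  by apply/funext => v; rewrite /gauss_fun expr2.
by rewrite /gauss_fun expr2; differentiate; ring.
Qed.

(** $2u^2e^{-u^2} - e^{-u^2}$ is the derivative of $-u e^{-u^2}$, so the integral
    equals that of the Gaussian. *)
Lemma Rintegral_sqr_gauss : \int[mu]_(u in `[0, +oo[) k u = Num.sqrt pi / 2.
Proof.
have [C2 P2] := powX_gauss_bound 2; have [C1 P1] := powX_gauss_bound 1.
have [C0 P0] := powX_gauss_bound 0.
have ik : mu.-integrable `[0, +oo[ (EFin \o k).
  apply: (@integrable_exp_dominated _ _ (2 * C2)); first exact: continuous_subspaceT.
  by move=> u u0; rewrite ger0_norm ?k0//; have := P2 _ u0; rewrite /k; lra.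
have ig : mu.-integrable `[0, +oo[ (EFin \o gauss_fun).
  apply: (@integrable_exp_dominated _ _ C0).
    by apply: continuous_subspaceT; exact: continuous_gauss_fun.
  by move=> u u0; rewrite ger0_norm ?expR_ge0//; have := P0 _ u0; rewrite expr0 mul1r.
have -> : Num.sqrt pi / 2 = \int[mu]_(u in `[0, +oo[) gauss_fun u.
  by rewrite /Rintegral integral0y_gauss.
apply/eqP; rewrite -subr_eq0 -RintegralB//; apply/eqP.
transitivity (0 - - (0 * @gauss_fun R 0)); last by rewrite mul0r opprK addr0.
apply: (@Rintegral_dominated_FTC2y _ _ (fun u => - (u * gauss_fun u)) (2 * C2 + C0)).
- move=> u; apply: cvgB; last by apply: continuous_subspaceT; exact: continuous_gauss_fun.
  exact: continuous_subspaceT.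
- move=> u u0; have := P2 _ u0; have := P0 _ u0; rewrite expr0 mul1r /k ler_norml.
  have : 0 <= u ^+ 2 * gauss_fun u by rewrite mulr_ge0 ?expR_ge0// sqr_ge0.
  have : 0 <= gauss_fun u by exact: expR_ge0.
  nra.
- by move=> u _; exact: XyE.
- apply: cvg_at_right_filter; apply: cvgN.
  by apply: cvgM; [exact: cvg_id|exact: continuous_gauss_fun].
- rewrite -[X in _ --> X]oppr0; apply: cvgN.
  have Ch : C1 * expR (- (t / 2)) @[t --> +oo] --> (0 : R).
    by rewrite -[X in _ --> X](mulr0 C1); apply: cvgM; [exact: cvg_cst|exact: cvg_expR_half].
  apply: (squeeze_cvgr _ (cvg_cst 0) Ch); near=> t.
  have t0 : 0 <= t by near: t; exact: nbhs_pinfty_ge.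
  have := P1 _ t0; rewrite expr1 => ->.
  by rewrite mulr_ge0 ?expR_ge0.
Unshelve. all: end_near. Qed.

Let f (t : R) : R := t `^ (3 / 2 - 1) * expR (- t).

(** The substitution $t = u^2$ is made on bounded intervals, since the derivative
    $2u$ has no finite limit at infinity; the ends $n^2$ and $n$ then go to
    infinity together. *)
Let subst n : (\int[mu]_(t in `[0%R, (n ^ 2)%:R]) (f t)%:E =
  \int[mu]_(u in `[0%R, n%:R]) (k u)%:E)%E.
Proof.
have d (u : R) : is_derive u 1 (fun u : R => u ^+ 2) (2 * u).
  have -> : (fun u : R => u ^+ 2) = (fun u => u * u) by apply/funext => v; rewrite expr2.
  by differentiate; ring.
have dE : (fun u : R => u ^+ 2)^`()%classic = (fun u => 2 * u).
  by apply/funext => u; rewrite derive1E; have [_ ->] := d u.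
have c2 : continuous (fun u : R => 2 * u).
  by move=> u; apply: cvgM; [exact: cvg_cst|exact: cvg_id].
have := @integration_by_substitution_increasing R (fun u => u ^+ 2) f 0 n%:R (ler0n _ n).
rewrite dE => h.
transitivity (\int[mu]_(t in `[(0 ^+ 2)%R, (n%:R ^+ 2)%R]) (f t)%:E)%E.
  by rewrite expr0n natrX.
rewrite h {h}.
- apply: eq_integral => u; rewrite inE/= in_itv/= => /andP[u0 _].
  rewrite /k /f /= !fctE /= (_ : 3 / 2 - 1 = 2^-1); last by lra.
  rewrite powR12_sqrt ?sqr_ge0// sqrtr_sqr ger0_norm//.
  by rewrite /gauss_fun; congr EFin; ring.
- move=> u v; rewrite !in_itv/= => /andP[u0 _] /andP[v0 _] uv.
  by rewrite ltrXn2r.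
- by move=> u _; exact: c2.
- by apply/cvg_ex; exists (2 * 0); apply: cvg_at_right_filter; exact: c2.
- by apply/cvg_ex; exists (2 * n%:R); apply: cvg_at_left_filter; exact: c2.
- split; first by move=> u _; have [] := d u.
  + by apply: cvg_at_right_filter; exact: exprn_continuous.
  + by apply: cvg_at_left_filter; exact: exprn_continuous.
- rewrite expr0n /=; apply: (@continuous_subspaceW R^o _ _ [set` `[0, +oo[%R]).
    by apply: subset_itvl; rewrite bnd_simp.
  apply: derivable_oy_Rcontinuous_within_itvcy; split.
    move=> t; rewrite in_itv/= andbT => t0.
    have d1 := is_derive_fun_powR (3 / 2 - 1) t0.
    have d2 := is_derive_fun_expR (is_derive_funN (is_derive_fun_id t)).
    by have [] := is_derive_funM d1 d2.
  apply: cvgM; first by apply: cvg_at_right_powR; lra.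
  apply: cvg_at_right_filter; apply: continuous_comp; first exact: opp_continuous.
  exact: continuous_expR.
Qed.

Lemma Gamma_three_half : Gamma (3 / 2) = Num.sqrt pi / 2 :> R.
Proof.
rewrite Gamma_itvcy; last by lra.
rewrite -Rintegral_sqr_gauss /Rintegral; congr fine.
have f0 t : 0 <= f t by rewrite mulr_ge0 ?powR_ge0 ?expR_ge0.
have mf : measurable_fun setT f.
  apply: measurable_funM => //.
  apply: continuous_measurable_fun => t; apply: continuous_comp; first exact: opp_continuous.
  exact: continuous_expR.
have mk : measurable_fun setT k.
  exact: continuous_measurable_fun.
have cf := @ge0_cvgn_integral R mu f f0 mf.
have := @ge0_cvgn_integral R mu k k0 mk.
under eq_fun do rewrite -subst.
move=> cvk; apply: (cvg_unique _ _ cvk) => //.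
apply: (cvg_comp (fun n => (n ^ 2)%N) _ _ cf).
apply/cvgnyPge => A; near=> n.
rewrite /= (@leq_trans n)//; first by near: n; exact: nbhs_infty_ge.
by rewrite -mulnn; case: (n) => // m; rewrite leq_pmulr.
Unshelve. all: end_near. Qed.
End Gamma_three_half.

(** * The error in Stirling's formula *)

(** The logarithm of $\Gamma$ is locked: linear arithmetic compares its atoms up to
    conversion and would otherwise unfold the integral. *)
Fact lnGamma_key : unit. Proof. by []. Qed.

Definition lnGamma (R : realType) : R -> R :=
  locked_with lnGamma_key (fun s => ln (Gamma s)).

Lemma lnGammaE (R : realType) (s : R) : lnGamma s = ln (Gamma s).
Proof. by rewrite /lnGamma unlock. Qed.

Section Stirling.
Context {R : realType}.
Implicit Types s x z m : R.

Definition stirling_exponent z := z * ln z - z + ln (2 * pi) / 2.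
Notation E := stirling_exponent.

Definition stirling_error x := lnGamma (x + 1) - E (x + 1 / 2).
Notation err := stirling_error.

(** $E$ is convex with derivative $\ln$. *)
Lemma stirling_exponent_tangent (a b : R) : 0 < a -> 0 < b ->
  (b - a) * ln a <= E b - E a.
Proof.
move=> a0 b0; have ba : 0 < b / a by rewrite divr_gt0.
have := ler_wpM2l (ltW b0) (ln_ge_1BV ba).
rewrite ln_div ?posrE// invf_div mulrBr mulr1.
rewrite (_ : b * (a / b) = a); last by field; lra.
rewrite /E; nra.
Qed.

Lemma lnGammaS s : 1 <= s -> lnGamma (s + 1) = ln s + lnGamma s.
Proof.
move=> s1; rewrite !lnGammaE GammaS// lnM// posrE ?Gamma_gt0//.
exact: lt_le_trans s1.
Qed.

Lemma lnGamma_le s x : 1 <= s -> 0 <= x <= 1 ->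
  lnGamma (s + x) <= x * ln s + lnGamma s.
Proof.
move=> s1 /[dup] x01 /andP[x0 x1].
have p : 0 < s `^ x by rewrite powR_gt0//; lra.
have sx1 : 1 <= s + x by lra.
rewrite !lnGammaE -ln_powR -lnM ?posrE ?Gamma_gt0//.
rewrite ler_ln ?posrE ?mulr_gt0 ?Gamma_gt0//.
exact: Gamma_shift_le.
Qed.

(** The step of length $1-x$ from $s+x$ ends at $s+1$, where $\Gamma$ is known. *)
Lemma lnGamma_ge s x : 1 <= s -> 0 <= x <= 1 ->
  lnGamma s + ln s - (1 - x) * ln (s + x) <= lnGamma (s + x).
Proof.
move=> s1 /andP[x0 x1].
have := @lnGamma_le (s + x) (1 - x) ltac:(lra) ltac:(lra).
rewrite (_ : s + x + (1 - x) = s + 1); last by ring.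
by rewrite lnGammaS//; lra.
Qed.

(** With $m = x+1$ and $t = 1/(2m)$ the increment is exactly $1 - m\,q(t)$, for $q$
    as in [entropy_le] and [entropy_ge]. *)
Lemma stirling_error_step x : 0 <= x ->
  0 <= err (x + 1) - err x <= 1 / (24 * x + 12) - 1 / (24 * (x + 1) + 12).
Proof.
move=> x0; pose m := x + 1; pose t := (2 * m)^-1.
have m0 : 0 < m by rewrite /m; lra.
have xm : x = m - 1 by rewrite /m; ring.
have tm : 2 * m * t = 1 by rewrite /t mulfV//; lra.
have t0 : 0 < t by rewrite invr_gt0; lra.
have t1 : t < 1 by rewrite /t invf_lt1; rewrite /m; lra.
have -> : err (x + 1) - err x =
    1 - m * ((1 + t) * ln (1 + t) - (1 - t) * ln (1 - t)).
  rewrite /stirling_error lnGammaS ?ler_wpDl// /E -/m.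
  have -> : m + 1 / 2 = m * (1 + t) by lra.
  have -> : x + 1 / 2 = m * (1 - t) by lra.
  rewrite !lnM ?posrE ?pi_gt0//; try lra.
  have : 2 * m * t * ln m = ln m by rewrite tm mul1r.
  lra.
have t01 : 0 <= t < 1 by lra.
have := entropy_le t01; have := entropy_ge t01.
set q := _ - _ * ln (1 - t) => q1 q2; apply/andP; split; first by nra.
have : m * (2 * t - t ^+ 3 / (3 * (1 - t ^+ 2))) <= m * q by rewrite ler_pM2l.
suff -> : 1 / (24 * x + 12) - 1 / (24 * (x + 1) + 12) = m * (t ^+ 3 / (3 * (1 - t ^+ 2))).
  by lra.
rewrite /t /m; field.
by repeat (apply/andP; split); nra.
Qed.

Lemma stirling_error_homo x (n k : nat) : 0 <= x -> (n <= k)%N ->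
  err (x + n%:R) <= err (x + k%:R).
Proof.
move=> x0 /subnK <-; elim: (k - n)%N => [|i ih]; first by rewrite add0n.
apply: (le_trans ih); rewrite addSn -natr1 addrA.
have := @stirling_error_step (x + (i + n)%:R) (addr_ge0 x0 (ler0n _ _)).
lra.
Qed.

Lemma stirling_error_decr x (n : nat) : 0 <= x ->
  err (x + n%:R) + 1 / (24 * (x + n%:R) + 12) <= err x + 1 / (24 * x + 12).
Proof.
move=> x0; elim: n => [|n]; first by rewrite addr0.
apply: le_trans; rewrite -natr1 addrA.
have := @stirling_error_step (x + n%:R) (addr_ge0 x0 (ler0n _ _)).
lra.
Qed.

(** The increments of $\ln\Gamma$ and of $E$ over a step $x$ are both squeezed
    around $x\ln s$. *)
Lemma stirling_error_near s x : 1 <= s -> 0 <= x <= 1 ->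
  `|err (s + x) - err s| <= s^-1.
Proof.
move=> s1 /[dup] x01 /andP[x0 x1].
have s11 : 1 <= s + 1 by lra.
have := lnGamma_le s11 x01; have := lnGamma_ge s11 x01.
have := @stirling_exponent_tangent (s + 1 / 2) (s + x + 1 / 2) ltac:(lra) ltac:(lra).
have := @stirling_exponent_tangent (s + x + 1 / 2) (s + 1 / 2) ltac:(lra) ltac:(lra).
rewrite /stirling_error (_ : s + x + 1 = s + 1 + x); last by ring.
rewrite (_ : s + x + 1 / 2 - (s + 1 / 2) = x); last by ring.
rewrite (_ : s + 1 / 2 - (s + x + 1 / 2) = - x); last by ring.
move=> e1 e2 g1 g2.
have sV : 0 < s^-1 by rewrite invr_gt0; lra.
have monoln (a b : R) : 0 < a -> a <= b -> ln a <= ln b.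
  by move=> a0 ab; rewrite ler_ln ?posrE//; lra.
have l1 : ln (s + 1) - ln (s + 1 / 2) <= s^-1.
  rewrite -ln_div ?posrE; try lra.
  have h : 0 < (s + 1) / (s + 1 / 2) by rewrite divr_gt0//; lra.
  apply: (le_trans (ln_le_B1 h)).
  rewrite (_ : (s + 1) / (s + 1 / 2) - 1 = (2 * s + 1)^-1); last first.
    by field; repeat (apply/andP; split); lra.
  by rewrite lef_pV2 ?posrE; lra.
have l2 : ln (s + 2) - ln (s + 1) <= s^-1.
  rewrite -ln_div ?posrE; try lra.
  have h : 0 < (s + 2) / (s + 1) by rewrite divr_gt0//; lra.
  apply: (le_trans (ln_le_B1 h)).
  rewrite (_ : (s + 2) / (s + 1) - 1 = (s + 1)^-1); last by field; lra.
  by rewrite lef_pV2 ?posrE; lra.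
have l3 := monoln (s + 1 + x) (s + 2) ltac:(lra) ltac:(lra).
have l4 := monoln (s + x + 1 / 2) (s + 2) ltac:(lra) ltac:(lra).
have l5 := monoln (s + 1 / 2) (s + 1) ltac:(lra) ltac:(lra).
rewrite ler_norml; apply/andP; split.
  have : (1 - x) * ln (s + 1 + x) <= (1 - x) * ln (s + 2) by rewrite ler_wpM2l//; lra.
  have : x * ln (s + x + 1 / 2) <= x * ln (s + 2) by rewrite ler_wpM2l//; lra.
  lra.
have : x * (ln (s + 1) - ln (s + 1 / 2)) <= ln (s + 1) - ln (s + 1 / 2).
  by rewrite ler_piMl//; lra.
lra.
Qed.

(** Legendre's duplication formula at integers, written so that every argument is
    at least 1.  The left-hand side does not change with $n$, by the functional
    equation, so only the value at 0 matters. *)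
Lemma lnGamma_duplication (n : nat) :
  lnGamma (n%:R + 3 / 2) + lnGamma (n%:R + 2) - lnGamma (2 * n%:R + 3)
  + (2 * n%:R + 2) * ln 2 = ln (pi : R) / 2.
Proof.
have pi0 := @pi_gt0 R.
elim: n => [|n ih].
  rewrite mulr0 !add0r (_ : 3 = 2 + 1 :> R); last by ring.
  rewrite (lnGammaS (s := 2)); last by lra.
  rewrite (_ : 2 + 1 = 3 :> R); last by ring.
  rewrite [lnGamma (3 / 2)]lnGammaE Gamma_three_half ln_div ?posrE ?sqrtr_gt0//.
  rewrite -powR12_sqrt ?ltW// ln_powR; lra.
have k0 : 0 <= n%:R :> R by exact: ler0n.
rewrite -ih -natr1.
rewrite (_ : n%:R + 1 + 3 / 2 = (n%:R + 3 / 2) + 1 :> R); last by ring.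
rewrite (_ : n%:R + 1 + 2 = (n%:R + 2) + 1 :> R); last by ring.
rewrite (_ : 2 * (n%:R + 1) + 3 = (2 * n%:R + 3) + 1 + 1 :> R); last by ring.
rewrite (lnGammaS (s := n%:R + 3 / 2)); last by lra.
rewrite (lnGammaS (s := n%:R + 2)); last by lra.
rewrite (lnGammaS (s := 2 * n%:R + 3 + 1)); last by lra.
rewrite (lnGammaS (s := 2 * n%:R + 3)); last by lra.
rewrite (_ : 2 * n%:R + 3 + 1 = 2 * (n%:R + 2) :> R); last by ring.
rewrite (_ : ln (2 * n%:R + 3) = ln 2 + ln (n%:R + 3 / 2) :> R); last first.
  by rewrite -lnM ?posrE; [congr ln; lra|lra|lra].
rewrite lnM ?posrE; lra.
Qed.

(** By the duplication formula the combination equals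
    $-(N\ln(N/c) + (N+\frac12)\ln((N+\frac12)/c))$ with $c = N+\frac14$ the
    midpoint: all constants cancel, including those with $\pi$.  The bounds
    $1-1/v\le\ln v\le v-1$ then enclose it. *)
Lemma stirling_error_duplication (n : nat) :
  - n.+1%:R^-1 <= err (n.+1%:R - 1 / 2) + err n.+1%:R - err (2 * n.+1%:R) <= 0.
Proof.
have pi0 := @pi_gt0 R.
set N : R := n.+1%:R.
have N1 : 1 <= N by rewrite ler1n.
have D : lnGamma (N + 1 / 2) + lnGamma (N + 1) - lnGamma (2 * N + 1)
  + 2 * N * ln 2 = ln (pi : R) / 2.
  rewrite -(lnGamma_duplication n) /N -natr1.
  rewrite (_ : n%:R + 1 + 1 / 2 = n%:R + 3 / 2 :> R); last by field.
  rewrite (_ : n%:R + 1 + 1 = n%:R + 2 :> R); last by field.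
  rewrite (_ : 2 * (n%:R + 1) + 1 = 2 * n%:R + 3 :> R); last by ring.
  ring.
pose c := N + 1 / 4.
have -> : err (N - 1 / 2) + err N - err (2 * N) =
    - (N * ln (N / c) + (N + 1 / 2) * ln ((N + 1 / 2) / c)).
  rewrite /stirling_error (_ : N - 1 / 2 + 1 = N + 1 / 2); last by field.
  rewrite subrK /E (_ : 2 * N + 1 / 2 = 2 * c); last by rewrite /c; field.
  have c0 : 0 < c by rewrite /c; lra.
  have Nc : N = c - 1 / 4 by rewrite /c; ring.
  rewrite !ln_div ?posrE ?lnM ?posrE//; try lra.
  by move: D; rewrite Nc; lra.
have cV : c^-1 <= N^-1 by rewrite lef_pV2 ?posrE /c; lra.
have NV : 0 < N^-1 by rewrite invr_gt0; lra.
have p1 : 0 < N / c by rewrite divr_gt0 /c; lra.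
have p2 : 0 < (N + 1 / 2) / c by rewrite divr_gt0 /c; lra.
have N0 : 0 <= N by lra.
have Nh0 : 0 <= N + 1 / 2 by lra.
have a1 := ler_wpM2l N0 (ln_le_B1 p1).
have a2 := ler_wpM2l Nh0 (ln_le_B1 p2).
have b1 := ler_wpM2l N0 (ln_ge_1BV p1).
have b2 := ler_wpM2l Nh0 (ln_ge_1BV p2).
have e1 : N * (N / c - 1) + (N + 1 / 2) * ((N + 1 / 2) / c - 1) = c^-1 / 8.
  by rewrite /c; field; lra.
have e2 : N * (1 - (N / c)^-1) + (N + 1 / 2) * (1 - ((N + 1 / 2) / c)^-1) = 0.
  by rewrite /c; field; repeat (apply/andP; split); lra.
have := lerD a1 a2; rewrite e1 => u1; have := lerD b1 b2; rewrite e2 => u2.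
rewrite lerN2 oppr_le0 u2 andbT (le_trans u1)// (le_trans _ cV)//.
by rewrite ler_piMr// ?invr_ge0 /c; lra.
Qed.

End Stirling.

(** * The limit of the error *)

Section stirling_limit.
Context {R : realType}.
Implicit Types x m : R.
Notation E := (@stirling_exponent R).
Notation err := (@stirling_error R).

Lemma cvg_mul_harmonic (c : R) : c * n.+1%:R^-1 @[n --> \oo] --> 0.
Proof.
rewrite -[X in _ --> X](mulr0 c); apply: cvgM; first exact: cvg_cst.
exact: cvg_harmonic.
Qed.

(** Monotone and bounded, hence convergent; the duplication formula makes the limit
    $\ell$ satisfy $2\ell - \ell = 0$. *)
Lemma stirling_error_nat_cvg : err n%:R @[n --> \oo] --> 0.
Proof.
have nd : nondecreasing_seq (fun n : nat => err n%:R).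
  by move=> n k nk; have := @stirling_error_homo R 0 n k (lexx _) nk; rewrite !add0r.
have [l ml] : exists l : R, err n%:R @[n --> \oo] --> l.
  apply/cvg_ex; apply: nondecreasing_is_cvgn => //.
  exists (err 0 + 1 / (24 * 0 + 12)) => _ [n _ <-].
  have := @stirling_error_decr R 0 n (lexx _); rewrite add0r.
  have : 0 <= 1 / (24 * n%:R + 12) :> R by rewrite divr_ge0 ?addr_ge0 ?mulr_ge0.
  lra.
have m2l : 2 * err n.+2%:R - err (2 * n.+2%:R) @[n --> \oo] --> 2 * l - l.
  apply: cvgB.
    apply: cvgM; first exact: cvg_cst.
    by have := ml; rewrite -(cvg_shiftn 2)/=; under eq_fun do rewrite addn2.
  rewrite (_ : (fun n : nat => _) = (fun n : nat => err n%:R) \o (fun n => (2 * n.+2)%N)); last first.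
    by apply/funext => n /=; rewrite natrM.
  apply: cvg_comp ml.
  apply/cvgnyPge => A; near=> n.
  have : (A <= n)%N by near: n; exact: nbhs_infty_ge.
  by move=> An; rewrite /= (leq_trans An)// (@leq_trans n.+2)// ?leq_pmull// !leqW.
(* Replacing the error at N - 1/2 by the error at N costs a further term of
   order 1/N. *)
have m20 : 2 * err n.+2%:R - err (2 * n.+2%:R) @[n --> \oo] --> 0.
  apply: (squeeze_cvgr _ (@cvg_mul_harmonic (- 3)) (@cvg_mul_harmonic 3)); near=> n.
  have /andP[d1 d2] := @stirling_error_duplication R n.+1.
  have n1 : 1 <= n.+1%:R :> R by rewrite ler1n.
  have NE : n.+2%:R = n.+1%:R + 1 :> R by rewrite natr1.
  move: (n.+2%:R : R) (n.+1%:R : R) NE n1 d1 d2 => N M NE M1 d1 d2.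
  have := @stirling_error_near R (N - 1 / 2) (1 / 2) ltac:(lra) ltac:(lra).
  rewrite subrK ler_norml => /andP[h1 h2].
  have V1 : N^-1 <= M^-1 by rewrite lef_pV2 ?posrE; lra.
  have V2 : (N - 1 / 2)^-1 <= M^-1 by rewrite lef_pV2 ?posrE; lra.
  by apply/andP; split; lra.
have e : 2 * l - l = 0 by apply: (cvg_unique _ m2l m20) => //.
by have <- : l = 0 by lra.
Unshelve. all: end_near. Qed.

(** The fractional part of $x$ is absorbed by [stirling_error_near]. *)
Lemma stirling_error_cvg x : 0 <= x -> err (x + n%:R) @[n --> \oo] --> 0.
Proof.
move=> x0; pose k := Num.truncn x; have /andP[kx xk] := truncn_itv x0.
rewrite -natr1 in xk.
have mk : err (k + n)%N%:R @[n --> \oo] --> 0.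
  have := stirling_error_nat_cvg; rewrite -(cvg_shiftn k)/=.
  by under eq_fun do rewrite addnC.
rewrite -cvg_shiftS/=.
have mk1 : err (k + n.+1)%N%:R @[n --> \oo] --> 0 by have := mk; rewrite -cvg_shiftS.
have lo : err (k + n.+1)%N%:R - 1 * n.+1%:R^-1 @[n --> \oo] --> 0.
  by rewrite -[X in _ --> X](subr0 0); apply: cvgB => //; exact: cvg_mul_harmonic.
have hi : err (k + n.+1)%N%:R + 1 * n.+1%:R^-1 @[n --> \oo] --> 0.
  by rewrite -[X in _ --> X](addr0 0); apply: cvgD => //; exact: cvg_mul_harmonic.
apply: (squeeze_cvgr _ lo hi); near=> n.
have k0 : 0 <= k%:R :> R by exact: ler0n.
have n1 : 1 <= n.+1%:R :> R by rewrite ler1n.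
have := @stirling_error_near R (k + n.+1)%N%:R (x - k%:R).
rewrite natrD => /(_ ltac:(lra) ltac:(lra)).
rewrite (_ : k%:R + n.+1%:R + (x - k%:R) = x + n.+1%:R); last by lra.
have : (k%:R + n.+1%:R)^-1 <= n.+1%:R^-1 :> R by rewrite lef_pV2 ?posrE; lra.
rewrite ler_norml => V /andP[h1 h2].
move: (n.+1%:R^-1 : R) V => NV V; rewrite !mul1r; apply/andP; split; lra.
Unshelve. all: end_near. Qed.

Lemma stirling_error_le0 x : 0 <= x -> err x <= 0.
Proof.
move=> x0; have mc := stirling_error_cvg x0.
have nd : nondecreasing_seq (fun n : nat => err (x + n%:R)).
  by move=> n k nk; exact: stirling_error_homo.
have := nondecreasing_cvgn_le nd (cvgP _ mc) 0%N.
by rewrite (cvg_lim _ mc)// addr0.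
Qed.

Lemma stirling_error_ge x : 0 <= x -> - (1 / (24 * x + 12)) <= err x.
Proof.
move=> x0; have mc := stirling_error_cvg x0.
suff : 0 <= err x + 1 / (24 * x + 12) by lra.
have {}mc : err (x + n.+1%:R) @[n --> \oo] --> 0 by rewrite -cvg_shiftS in mc.
apply: (cvgr_to_le mc); apply: nearW => n.
have := stirling_error_decr n.+1 x0.
have : 0 <= 1 / (24 * (x + n.+1%:R) + 12) by rewrite divr_ge0 ?addr_ge0 ?mulr_ge0 ?addr_ge0.
lra.
Qed.

End stirling_limit.

(** * Bounds for the ratio *)

Section ratio_bounds.
Context {R : realType}.
Implicit Types x m : R.
Notation E := (@stirling_exponent R).
Notation err := (@stirling_error R).

(** Binet's function, the error of the classical form
    $\Gamma(m)\approx\sqrt{2\pi}\,m^{m-1/2}e^{-m}$ of Stirling's formula. *)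
Definition binet m := lnGamma m + ln m / 2 - E m.

(** The decrement of $J$ is $(m+\frac12)\ln(1+1/m) - 1$. *)
Lemma binet_step m : 1 <= m ->
  binet m - 1 / (12 * m) <= binet (m + 1) - 1 / (12 * (m + 1)).
Proof.
move=> m1; pose h := m + 1 / 2; pose t := (2 * h)^-1.
have h0 : 0 < h by rewrite /h; lra.
have tm : 2 * h * t = 1 by rewrite /t mulfV//; lra.
have t0 : 0 < t by rewrite invr_gt0; lra.
have t1 : t < 1 by rewrite /t invf_lt1; rewrite /h; lra.
have hE : h = m + 1 / 2 by [].
have tE : t = (2 * h)^-1 by [].
clearbody t h.
have mh : m = h * (1 - t) by rewrite mulrBr; lra.
have m1h : m + 1 = h * (1 + t) by rewrite mulrDr; lra.
have := @artanh_le R t ltac:(lra).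
have lnE : ln (m + 1) - ln m = ln (1 + t) - ln (1 - t).
  have -> : ln m = ln h + ln (1 - t) by rewrite [in LHS]mh lnM ?posrE//; lra.
  have -> : ln (m + 1) = ln h + ln (1 + t) by rewrite m1h lnM ?posrE//; lra.
  ring.
rewrite -lnE -(ler_pM2l h0) => art.
have alg : h * (2 * t + 2 * t ^+ 3 / (3 * (1 - t ^+ 2))) =
    1 + (1 / (12 * m) - 1 / (12 * (m + 1))).
  by rewrite tE hE; field; repeat (apply/andP; split); nra.
rewrite alg hE in art.
rewrite /binet lnGammaS// /E; lra.
Qed.

(** A crude bound, enough to see that $J$ is asymptotically nonpositive: $J(m)$
    differs from the error at $m-1$, which is nonpositive, by at most the gap
    between $\frac12\ln m$ and the increment of $E$ from $m-\frac12$ to $m$. *)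
Lemma binet_le_inv m : 1 <= m -> binet m <= m^-1.
Proof.
move=> m1; have := @stirling_error_le0 R (m - 1) ltac:(lra).
rewrite /stirling_error subrK (_ : m - 1 + 1 / 2 = m - 1 / 2); last by field.
have := @stirling_exponent_tangent R (m - 1 / 2) m ltac:(lra) ltac:(lra).
have q : 0 < m / (m - 1 / 2) by rewrite divr_gt0//; lra.
have := ln_le_B1 q; rewrite ln_div ?posrE; try lra.
rewrite (_ : m / (m - 1 / 2) - 1 = (2 * m - 1)^-1); last by field; repeat (apply/andP; split); lra.
have : (2 * m - 1)^-1 <= m^-1 by rewrite lef_pV2 ?posrE; lra.
have : 0 < m^-1 by rewrite invr_gt0; lra.
rewrite /binet; lra.
Qed.

Lemma binet_le m : 1 <= m -> binet m <= 1 / (12 * m).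
Proof.
move=> m1; suff : binet m - 1 / (12 * m) <= 0 by lra.
apply: (cvgr_to_ge (@cvg_mul_harmonic R 1)); apply: nearW => n; rewrite mul1r.
have mono : binet m - 1 / (12 * m) <=
    binet (m + n.+1%:R) - 1 / (12 * (m + n.+1%:R)).
  elim: n.+1 => [|k ih]; first by rewrite addr0.
  apply: (le_trans ih); rewrite -[k.+1%:R]natr1 addrA; apply: binet_step.
  by rewrite ler_wpDr.
have n0 : 0 < n.+1%:R :> R by rewrite ltr0n.
move: (n.+1%:R : R) n0 mono => N N0 mono.
have := @binet_le_inv (m + N) ltac:(lra).
have : (m + N)^-1 <= N^-1 by rewrite lef_pV2 ?posrE; lra.
have : 0 <= 1 / (12 * (m + N)) by rewrite divr_ge0//; lra.
lra.
Qed.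

(** The logarithm of $\widehat\Pi(x,a)/S_{1/2}(x+a)$. *)
Definition log_ratio x a := lnGamma (x + 1) + a * ln (x + 1) - E (x + a + 1 / 2).

Lemma log_ratio_ge x a : 0 <= x -> 0 <= a <= 1 ->
  - (1 / (24 * (x + a) + 12)) <= log_ratio x a.
Proof.
move=> x0 /andP[a0 a1]; rewrite /log_ratio.
have [a2|a2] := leP (1 / 2) a.
  (* Here E(x + 3/2) - E(x + a + 1/2) >= (1 - a) ln(x + a + 1/2), and the
     logarithm is at least ln(x + 1): the ratio is at least its value at 1. *)
  have := @stirling_error_ge R (x + 1) ltac:(lra).
  have : 1 / (24 * (x + 1) + 12) <= 1 / (24 * (x + a) + 12).
    by rewrite !div1r lef_pV2 ?posrE; lra.
  rewrite /stirling_error lnGammaS; last by lra.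
  have := @stirling_exponent_tangent R (x + a + 1 / 2) (x + 1 + 1 / 2) ltac:(lra) ltac:(lra).
  rewrite (_ : x + 1 + 1 / 2 - (x + a + 1 / 2) = 1 - a); last by ring.
  have : ln (x + 1) <= ln (x + a + 1 / 2) by rewrite ler_ln ?posrE; lra.
  have a1' : 0 <= 1 - a by lra.
  move=> /(ler_wpM2l a1'); lra.
have := stirling_error_ge x0; rewrite /stirling_error.
set z0 := x + 1 / 2; pose z := z0 + a; pose m := z0 + 1 / 2.
have z01 : 1 / 2 <= z0 by rewrite /z0; lra.
have -> : x + a + 1 / 2 = z by rewrite /z /z0; ring.
have -> : x + 1 = m by rewrite /m /z0; field.
have -> : 24 * x + 12 = 24 * z0 by rewrite /z0; field.
have -> : 24 * (x + a) + 12 = 24 * z by rewrite /z /z0; field.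
have zE : z = z0 + a by [].
have mE : m = z0 + 1 / 2 by [].
clearbody z m z0; clear x x0 => mu0.
(* It remains to see that the ratio grows from 0 to a at least as fast as its
   lower bound does. *)
suff : 1 / (24 * z0) - 1 / (24 * z) <= a * ln m - E z + E z0 by lra.
have u0 : 0 <= a / z0 by rewrite divr_ge0//; lra.
have := ln_le_half_sub_inv u0.
have -> : 1 + a / z0 = z / z0 by rewrite zE; field; lra.
rewrite ln_div ?posrE; try lra.
have z00 : 0 <= z0 by lra.
move=> /(ler_wpM2l z00).
have -> : z0 * (a / z0 - (a / z0) ^+ 2 / (2 * (z / z0))) = a - a ^+ 2 / (2 * z).
  by field; repeat (apply/andP; split); lra.
move=> l1.
have mz : 0 < m / z by rewrite divr_gt0; lra.
have := ler_wpM2l a0 (ln_ge_1BV mz).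
rewrite ln_div ?posrE; try lra.
have -> : a * (1 - (m / z)^-1) = a * (1 / 2 - a) / m.
  by rewrite mE zE; field; repeat (apply/andP; split); lra.
move=> l2.
suff : 1 / (24 * z0) - 1 / (24 * z) <= a * (1 / 2 - a) / m + a ^+ 2 / (2 * z).
  rewrite /E; nra.
have -> : 1 / (24 * z0) - 1 / (24 * z) = a / (24 * z0 * z).
  by rewrite zE; field; repeat (apply/andP; split); lra.
(* Since z0 >= 1/2 and m <= 2 z, both sides are compared with multiples of a / z:
   at most 1/12 on the left, at least 1/4 on the right. *)
have l3 : a / (24 * z0 * z) <= a / (12 * z).
  by rewrite ler_wpM2l// lef_pV2 ?posrE; nra.
have l4 : a * (1 / 2 - a) / (2 * z) <= a * (1 / 2 - a) / m.
  by rewrite ler_wpM2l ?mulr_ge0// ?lef_pV2 ?posrE; nra.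
have l5 : a / (12 * z) <= a * (1 / 2 - a) / (2 * z) + a ^+ 2 / (2 * z).
  rewrite -subr_ge0 (_ : _ - _ = a / (6 * z)); last by field; lra.
  by rewrite divr_ge0//; lra.
lra.
Qed.

(** The bound with $c = \frac1{24}$, that is
    $12(x+a)+\frac{11}2 = 12(m+s-\frac1{24})$ where $m = x+1$ and
    $s = a-\frac12$. *)
Lemma log_ratio_le x a : 0 <= x -> 0 <= a <= 1 ->
  log_ratio x a <= 1 / (12 * (x + a) + 11 / 2).
Proof.
move=> x0 /andP[a0 a1]; rewrite /log_ratio.
pose m := x + 1; pose s := a - 1 / 2.
have m1 : 1 <= m by rewrite /m; lra.
have -> : x + a + 1 / 2 = m + s by rewrite /m /s; field.
have -> : 12 * (x + a) + 11 / 2 = 12 * (m + s - 1 / 24) by rewrite /m /s; field.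
have -> : a = s + 1 / 2 by rewrite /s; ring.
rewrite -/m.
have s0 : - (1 / 2) <= s <= 1 / 2 by rewrite /s; lra.
clearbody m s; move: s0 => /andP[s0 s2]; clear x a x0 a0 a1.
have ms : 0 < m + s by lra.
suff : binet m - ((m + s) * (ln (m + s) - ln m) - s) <= 1 / (12 * (m + s - 1 / 24)).
  by rewrite /binet /E; lra.
have := binet_le m1.
have [sc|sc] := leP s (1 / 24).
  (* The bound is then at least 1 / (12 m), and the correction to J is
     nonpositive. *)
  have q : 0 < (m + s) / m by rewrite divr_gt0//; lra.
  have ms0 : 0 <= m + s by lra.
  have := ler_wpM2l ms0 (ln_ge_1BV q).
  rewrite ln_div ?posrE; try lra.
  have -> : (m + s) * (1 - ((m + s) / m)^-1) = s by field; repeat (apply/andP; split); lra.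
  have : 1 / (12 * m) <= 1 / (12 * (m + s - 1 / 24)).
    by rewrite !div1r lef_pV2 ?posrE; lra.
  lra.
have u0 : 0 <= s / m by rewrite divr_ge0; lra.
have m0 : 0 <= m by lra.
have := ler_wpM2l m0 (bennett_ge u0).
have -> : m * ((1 + s / m) * ln (1 + s / m) - s / m) = (m + s) * (ln (m + s) - ln m) - s.
  have -> : 1 + s / m = (m + s) / m by field; lra.
  by rewrite ln_div ?posrE; [field; lra|lra|lra].
have -> : m * (3 * (s / m) ^+ 2 / (2 * (3 + s / m))) = 3 * s ^+ 2 / (2 * (3 * m + s)).
  by field; repeat (apply/andP; split); lra.
suff : 1 / (12 * m) - 1 / (12 * (m + s - 1 / 24)) <= 3 * s ^+ 2 / (2 * (3 * m + s)).
  lra.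
have -> : 1 / (12 * m) - 1 / (12 * (m + s - 1 / 24)) =
    (s - 1 / 24) / (12 * m * (m + s - 1 / 24)).
  by field; repeat (apply/andP; split); lra.
rewrite ler_pdivrMr; last by nra.
rewrite mulrAC ler_pdivlMr; last by lra.
(* A polynomial inequality in m >= 1 and d = s - 1/24, tight for large m at
   s = 1/12: the square 6 (s - 1/12)^2 = 6 s^2 - s + 1/24 is isolated. *)
set d := s - 1 / 24; have -> : m + s - 1 / 24 = m + d by rewrite /d; ring.
have -> : s = d + 1 / 24 by rewrite /d; ring.
have d0 : 0 < d by rewrite /d; lra.
have d1 : d <= 11 / 24 by rewrite /d; lra.
clearbody d.
rewrite -subr_ge0.
have -> : 3 * (d + 1 / 24) ^+ 2 * (12 * m * (m + d)) - d * (2 * (3 * m + (d + 1 / 24)))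
  = 2 * (d * (3 * m * (m - 1)) + d * (3 * d * (m - 1)) + d * (2 * d - 1 / 24)
      + 18 * (d - 1 / 24) ^+ 2 * (m * (m + d))) by field.
have dm : 0 <= d * (m - 1) by rewrite mulr_ge0//; lra.
have p1 : 0 <= d * (3 * m * (m - 1)) by nra.
have p2 : 0 <= d * (3 * d * (m - 1)) by nra.
have q0 : 0 <= 18 * (d - 1 / 24) ^+ 2 by rewrite mulr_ge0// sqr_ge0.
have q1 : 1 <= m * (m + d) by nra.
have p3 := ler_peMr q0 q1.
have p4 : 0 <= d * (2 * d - 1 / 24) + 18 * (d - 1 / 24) ^+ 2 by nra.
nra.
Qed.

Lemma S_half_expR x : - (1 / 2) < x -> S_half x = expR (E (x + 1 / 2)).
Proof.
move=> x0; have y0 : 0 < x + 1 / 2 by lra.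
have p0 : 0 < 2 * pi :> R by rewrite mulr_gt0// pi_gt0.
rewrite /S_half -powR12_sqrt ?ltW// /powR !gt_eqF// -!expRD /E.
by congr expR; field.
Qed.

Lemma Pi_hat_expR x a : 0 <= x -> Pi_hat x a = expR (lnGamma (x + 1) + a * ln (x + 1)).
Proof.
move=> x0; have x1 : 1 <= x + 1 by lra.
have x2 : 1 <= x + 1 + 1 by lra.
rewrite /Pi_hat /Pi_fun /powR !gt_eqF ?Gamma_gt0// -!lnGammaE (lnGammaS x1).
by rewrite -expRD; congr expR; ring.
Qed.

End ratio_bounds.

Theorem theorem33 (R : realType) (x alpha : R)
  (hx : 0 <= x) (halpha0 : 0 <= alpha) (halpha1 : alpha <= 1) :
  expR (- (1 / (24 * (x + alpha) + 12)))
    <= Pi_hat x alpha / S_half (x + alpha)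
  /\
  Pi_hat x alpha / S_half (x + alpha)
    <= expR (1 / (12 * (x + alpha) + 12 - 6 * expR (1 / 12))).
Proof.
have a01 : 0 <= alpha <= 1 by lra.
have -> : Pi_hat x alpha / S_half (x + alpha) = expR (log_ratio x alpha).
  by rewrite Pi_hat_expR// S_half_expR -?expRB//; lra.
rewrite !ler_expR; split; first exact: log_ratio_ge.
apply: (le_trans (log_ratio_le hx a01)).
(* The lower bound compares the denominators, the upper one shows that the smaller
   of them is positive. *)
have e1 : 1 + 1 / 12 <= expR (1 / 12 : R) by exact: expR_ge1Dx.
have e2 : expR (1 / 12 : R) <= 12 / 11.
  have := @expR_ge1Dx R (- (1 / 12)); rewrite expRN => h.
  have e0 := expR_gt0 (1 / 12 : R).
  have := ler_wpM2r (ltW e0) h; rewrite mulVf ?gt_eqF//.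
  lra.
by rewrite !div1r in e1 e2 *; rewrite lef_pV2 ?posrE; lra.
Qed.
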